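(* Let $n,k\ge 1$ be integers and let $A_1,\dots,A_k,B_1,\dots,B_k,C\in\mathcal{M}_n(\mathbb{C})$ be such that $\mathcal{N}=\{A_1,\dots,A_k,B_1,\dots,B_k,C\}$ is a commuting set of diagonalizable matrices. Let $S\in\mathfrak{S}(\mathcal{N})$. If $V\in\mathfrak{S}(\mathcal{N})$, then there is a permutation $\sigma\in\mathcal{S}_n$ such that $\Gamma^V=P_\sigma^{-1}\Gamma^SP_\sigma$, where $\Gamma^S$ and $\Gamma^V$ are the relevant matrices with respect to $S$ and $V$.
   Context: $\mathcal{M}_n(\mathbb{C})$ is the set of complex $n\times n$ matrices. A set of matrices is commuting if any two of its elements commute. For a diagonalizable $M\in\mathcal{M}_n(\mathbb{C})$, $\mathfrak{S}(M)$ is the set of invertible $S\in\mathcal{M}_n(\mathbb{C})$ such that $S^{-1}MS$ is diagonal, and for $S\in\mathfrak{S}(M)$, $\Delta_M(S)\in\mathbb{C}^n$ is the vector $\mathbf{m}$ with $\mathrm{diag}(\mathbf{m})=S^{-1}MS$. For a set $\mathcal{N}$ of diagonalizable matrices, $\mathfrak{S}(\mathcal{N})=\bigcap_{M\in\mathcal{N}}\mathfrak{S}(M)$. For $S\in\mathfrak{S}(\mathcal{N})$ put $\mathbf{a}^j=\Delta_{A_j}(S)=(a^j_1,\dots,a^j_n)$ and $\mathbf{b}^j=\Delta_{B_j}(S)=(b^j_1,\dots,b^j_n)$; the relevant matrix with respect to $S$ is $\Gamma^S\in\mathcal{M}_n(\mathbb{C})$ with entries $\Gamma^S_{rs}=\sum_{j=1}^ka^j_rb^j_s$.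 $\mathcal{S}_n$ is the set of permutations of $\{1,\dots,n\}$, and $P_\sigma$ is the permutation matrix with columns $\mathbf{e}_{\sigma(1)},\dots,\mathbf{e}_{\sigma(n)}$ (canonical basis vectors), i.e. $(P_\sigma)_{ij}=\delta_{i\sigma(j)}$. *)

(* Defs.v *)
From HB Require Import structures.
From mathcomp Require Import all_boot all_order all_fingroup all_algebra.
From mathcomp Require Import boolp classical_sets reals.
From mathcomp Require Import complex.

Set Implicit Arguments.
Unset Strict Implicit.
Unset Printing Implicit Defensive.

Import Order.TTheory GRing.Theory Num.Theory.
Local Open Scope classical_set_scope.
Local Open Scope ring_scope.

(* The field of complex numbers is R[i] for R : realType. *)

Section Diagonalizers.
Variables (R : realType) (n : nat).
Implicit Types (M S : 'M[R[i]]_n) (N : set 'M[R[i]]_n).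

Definition commuting_set N : Prop :=
  forall M1 M2, N M1 -> N M2 -> comm_mx M1 M2.

(* MathComp's [diagonalizable] asks for an invertible P with P M P^-1
   diagonal, that is, S^-1 M S diagonal for S = P^-1. *)
Definition diagonalizable_set N : Prop :=
  forall M, N M -> diagonalizable M.

Definition diagonalizers M : set 'M[R[i]]_n :=
  [set S | S \in unitmx /\ is_diag_mx (invmx S *m M *m S)].

Definition diagonalizers_set N : set 'M[R[i]]_n :=
  \bigcap_(M in N) diagonalizers M.

(* Meaningful when S is in [diagonalizers M]; see [diag_mx_Delta]. *)
Definition Delta M S : 'rV[R[i]]_n :=
  \row_(r < n) (invmx S *m M *m S) r r.

Lemma diag_mx_Delta M S :
  diagonalizers M S -> diag_mx (Delta M S) = invmx S *m M *m S.
Proof.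
move=> [_ /is_diag_mxP dg]; apply/matrixP => i j; rewrite mxE.
have [<-|nij] := eqVneq i j; first by rewrite mulr1n mxE.
by rewrite mulr0n dg.
Qed.

Definition relevant_mx (k : nat) (A B : 'I_k -> 'M[R[i]]_n) S : 'M[R[i]]_n :=
  \matrix_(r < n, s < n)
    \sum_(j < k) Delta (A j) S ord0 r * Delta (B j) S ord0 s.

(* Column j is the canonical basis vector of index s j. MathComp's [perm_mx s]
   is the transpose (equivalently, the inverse) of this matrix. *)
Definition perm_col_mx (s : 'S_n) : 'M[R[i]]_n :=
  \matrix_(i < n, j < n) (i == s j)%:R.

Lemma perm_col_mxE (s : 'S_n) : perm_col_mx s = perm_mx s^-1%g.
Proof.
apply/matrixP => i j; rewrite !mxE; congr (_%:R).
by rewrite (can2_eq (permKV s) (permK s)).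
Qed.

End Diagonalizers.

Arguments perm_col_mx {R n} s.

(* Main.v *)
(* If V and S diagonalize the same M, then T = S^-1 V intertwines the two
   diagonal forms, so d_i T_ij = T_ij d'_j. As det T <> 0, some term of the
   Leibniz formula is nonzero, which gives a permutation t, depending only on S
   and V, with T_(i, t i) <> 0 for all i; hence d_i = d'_(t i) for every M
   simultaneously. *)

Require Import Defs.
From mathcomp Require Import all_boot all_order all_fingroup all_algebra.
From mathcomp Require Import boolp classical_sets reals.
From mathcomp Require Import complex.

Set Implicit Arguments.
Unset Strict Implicit.
Unset Printing Implicit Defensive.

Import Order.TTheory GRing.Theory Num.Theory.
Local Open Scope classical_set_scope.
Local Open Scope ring_scope.

Lemma unitmx_perm_neq0 (F : fieldType) (n : nat) (T : 'M[F]_n) :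
  T \in unitmx -> exists t : 'S_n, forall i, T i (t i) != 0.
Proof.
rewrite unitmxE unitfE => detT.
have [/existsP[t /forallP Tt]|noT] :=
  boolP [exists t : 'S_n, [forall i, T i (t i) != 0]]; first by exists t.
case/eqP: detT; rewrite /determinant big1 // => t _.
have /forallPn[j] := existsPn noT t; rewrite negbK => /eqP Tj0.
by rewrite (bigD1 j) //= Tj0 mul0r mulr0.
Qed.

Lemma Delta_eq (R : realType) (n : nat) (M S V : 'M[R[i]]_n) (i j : 'I_n) :
  diagonalizers M S -> diagonalizers M V -> (invmx S *m V) i j != 0 ->
  Delta M V ord0 j = Delta M S ord0 i.
Proof.
move=> dS dV Tij; have [Su _] := dS; have [Vu _] := dV.
have : diag_mx (Delta M S) *m (invmx S *m V)
     = (invmx S *m V) *m diag_mx (Delta M V).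
  (* Cancelling [S *m invmx S] on the left and [V *m invmx V] on the right leaves
     [invmx S *m M *m V] on both sides. *)
  by rewrite !diag_mx_Delta // !mulmxA mulmxK // mulmxK.
move: (invmx S *m V) Tij => T Tij /matrixP/(_ i j).
by rewrite mul_diag_mx mul_mx_diag [LHS]mxE [RHS]mxE mulrC => /(mulfI Tij).
Qed.

Lemma conj_perm_col_mxE (R : realType) (n : nat) (s : 'S_n) (G : 'M[R[i]]_n)
    (i j : 'I_n) :
  (invmx (perm_col_mx s) *m G *m perm_col_mx s) i j = G (s i) (s j).
Proof.
have invP : invmx (perm_col_mx s) = perm_mx s :> 'M[R[i]]_n.
  (* The identity is factored as [perm_mx s^-1 *m perm_mx s], so that the inverse cancels the first
     factor. *)
  rewrite perm_col_mxE -[LHS]mulmx1 -(@perm_mx1 _ n) -(mulVg s) perm_mxM.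
  by rewrite mulKmx ?unitmx_perm.
by rewrite invP perm_col_mxE -col_permE -row_permE !mxE.
Qed.

Theorem lemma2p2 (R : realType) (n k : nat) (hn : (0 < n)%N) (hk : (0 < k)%N)
    (A B : 'I_k -> 'M[R[i]]_n) (C : 'M[R[i]]_n) (N : set 'M[R[i]]_n)
    (hN : N = range A `|` range B `|` [set C])
    (hcomm : commuting_set N) (hdiag : diagonalizable_set N)
    (S : 'M[R[i]]_n) (hS : diagonalizers_set N S)
    (V : 'M[R[i]]_n) (hV : diagonalizers_set N V) :
  exists s : 'S_n,
    relevant_mx A B V
      = invmx (perm_col_mx s) *m relevant_mx A B S *m perm_col_mx s.
Proof.
have [t Tt] : exists t : 'S_n, forall i, (invmx S *m V) i (t i) != 0.
  apply: unitmx_perm_neq0.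
  (* Invertibility of [S] and [V] is read off from one member of [N]: an intersection over an empty
     family would impose nothing. *)
  have NC : N C by rewrite hN; right.
  have [Su _] := hS _ NC; have [Vu _] := hV _ NC.
  by rewrite unitmx_mul unitmx_inv Su.
have DeltaV M r : N M -> Delta M V ord0 r = Delta M S ord0 (t^-1%g r).
  move=> NM; apply: Delta_eq (hS _ NM) (hV _ NM) _.
  by have := Tt (t^-1%g r); rewrite permKV.
(* The inverse of [t] appears because [t] sends indices for [S] to indices for [V], while
   conjugation reads entry (r, s) of the new matrix at the images of r and s in the old one. *)
exists t^-1%g; apply/matrixP => r s; rewrite conj_perm_col_mxE !mxE.
apply: eq_bigr => j _; rewrite !DeltaV //.
- by rewrite hN; left; right; exists j.
- by rewrite hN; left; left; exists j.
Qed.
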